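(* Suppose that the following statement (Oda's Conjecture) holds: for every $n$ and all lattice polytopes $P,Q\subset\mathbb{R}^n$ with $Q$ smooth and the normal fan of $Q$ refining that of $P$, one has $(P+Q)\cap\mathbb{Z}^n=(P\cap\mathbb{Z}^n)+(Q\cap\mathbb{Z}^n)$. Then all smooth lattice polytopes containing the origin, in particular all monotone polytopes, are neat.
   Context: $A+B:=\{a+b:a\in A,b\in B\}$ is the Minkowski sum. An $n$-dimensional polytope in $\mathbb{R}^n$ is smooth if it is simple, rational, and the primitive edge-direction vectors at each vertex form a basis of $\mathbb{Z}^n$; it is a lattice polytope if its vertices are in $\mathbb{Z}^n$. A lattice polytope with the origin in its interior is reflexive if every facet-defining inequality is of the form $u_F\cdot x\le1$ with $u_F\in\mathbb{Z}^n$ the primitive exterior normal of the facet; monotone means smooth and reflexive. Two polytopes are normally isomorphic if they have the same normal fan. Neat. Let $P=\{x\in\mathbb{R}^n: Ax\le c\}$ be the irredundant facet description of a smooth lattice polytope, with $A\in\mathbb{Z}^{m\times n}$ having primitive rows and $c\in\mathbb{Z}^m$. For $b\in\mathbb{Z}^m$ put $P_b:=\{x\in\mathbb{R}^n:Ax\le c+b\}$. $P$ is neat if for every $b\in\mathbb{Z}^m$ such that both $P_b$ and $P_{-b}$ are normally isomorphic to $P$, one has $P_b\cap(-P_{-b})\cap\mathbb{Z}^n\neq\varnothing$. *)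

(* Defs.v *)
From HB Require Import structures.
From mathcomp Require Import all_boot all_order all_algebra.
From mathcomp Require Import all_classical all_reals.
From mathcomp Require Import topology normedtype.

Set Implicit Arguments.
Unset Strict Implicit.
Unset Printing Implicit Defensive.

Import Order.TTheory GRing.Theory Num.Theory.
Import numFieldNormedType.Exports.

Local Open Scope classical_set_scope.
Local Open Scope card_scope.
Local Open Scope ring_scope.

(* Points of R^n are column vectors; linear functionals (normal vectors) are
   row vectors, paired with points by [dotp]. *)

Section Polytopes.
Variable R : realType.

Definition dotp (n : nat) (u : 'rV[R]_n) (x : 'cV[R]_n) : R := (u *m x) 0 0.

Definition toR (m n : nat) (M : 'M[int]_(m, n)) : 'M[R]_(m, n) := map_mx intr M.

Definition lattice (n : nat) : set 'cV[R]_n := range (@toR n 1).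

Definition minkowski_sum (n : nat) (P Q : set 'cV[R]_n) : set 'cV[R]_n :=
  [set p + q | p in P & q in Q].

(* The gcd of the entries is 1 (so a primitive vector is nonzero). *)
Definition primitive (m n : nat) (M : 'M[int]_(m, n)) : Prop :=
  forall d : nat, (forall i j, (d %| `|M i j|)%N) -> d = 1%N.

(* The columns of V are the points whose convex hull is taken. *)
Definition conv_hull (n k : nat) (V : 'M[R]_(n, k)) : set 'cV[R]_n :=
  [set V *m w | w in [set w : 'cV[R]_k |
     (forall i, 0 <= w i 0) /\ \sum_i w i 0 = 1]].

(* Polytopes need not be full-dimensional. *)
Definition polytope (n : nat) (P : set 'cV[R]_n) : Prop :=
  exists (k : nat) (V : 'M[R]_(n, k)), P = conv_hull V.

(* The affine hull of S is nonempty of dimension d: its direction, i.e. the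
   smallest subspace containing all differences of points of S, has
   dimension d. *)
Definition has_dim (n : nat) (S : set 'cV[R]_n) (d : nat) : Prop :=
  S !=set0 /\
  exists2 V : {vspace 'cV[R]_n},
    (forall W : {vspace 'cV[R]_n},
       (V <= W)%VS <-> (forall x y, S x -> S y -> x - y \in W)) &
    (\dim V)%VS = d.

Definition max_face (n : nat) (P : set 'cV[R]_n) (u : 'rV[R]_n) :
    set 'cV[R]_n :=
  [set x | P x /\ forall y, P y -> dotp u y <= dotp u x].

(* Nonempty faces only; P itself is a face (take u = 0). *)
Definition face (n : nat) (P F : set 'cV[R]_n) : Prop :=
  F !=set0 /\ exists u : 'rV[R]_n, F = max_face P u.

Definition vertex (n : nat) (P : set 'cV[R]_n) (v : 'cV[R]_n) : Prop :=
  face P [set v].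

Definition edge (n : nat) (P E : set 'cV[R]_n) : Prop :=
  face P E /\ has_dim E 1.

Definition facet (n : nat) (P F : set 'cV[R]_n) : Prop :=
  face P F /\ exists2 d, has_dim P d.+1 & has_dim F d.

Definition lattice_polytope (n : nat) (P : set 'cV[R]_n) : Prop :=
  polytope P /\ forall v, vertex P v -> lattice v.

Definition normal_cone (n : nat) (P F : set 'cV[R]_n) : set 'rV[R]_n :=
  [set u | F `<=` max_face P u].

Definition normal_fan (n : nat) (P : set 'cV[R]_n) : set (set 'rV[R]_n) :=
  [set normal_cone P F | F in face P].

Definition refines (n : nat) (Sigma' Sigma : set (set 'rV[R]_n)) : Prop :=
  \bigcup_(C in Sigma') C = \bigcup_(C in Sigma) C /\
  forall C', Sigma' C' -> exists2 C, Sigma C & C' `<=` C.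

Definition normally_isomorphic (n : nat) (P Q : set 'cV[R]_n) : Prop :=
  normal_fan P = normal_fan Q.

(* Integer vector e spanning the edge E from its endpoint v. *)
Definition edge_direction (n : nat) (v : 'cV[R]_n) (E : set 'cV[R]_n)
    (e : 'cV[int]_n) : Prop :=
  forall x, E x -> exists2 t : R, 0 <= t & x = v + t *: toR e.

Definition simple_polytope (n : nat) (P : set 'cV[R]_n) : Prop :=
  [/\ polytope P, has_dim P n &
      forall v, vertex P v -> [set E | edge P E /\ E v] #= `I_n].

Definition rational_polytope (n : nat) (P : set 'cV[R]_n) : Prop :=
  polytope P /\
  forall v E, vertex P v -> edge P E -> E v ->
    exists e : 'cV[int]_n, edge_direction v E e.

Definition primitive_edge_vectors (n : nat) (P : set 'cV[R]_n)
    (v : 'cV[R]_n) : set 'cV[int]_n :=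
  [set e | primitive e /\ exists E, [/\ edge P E, E v & edge_direction v E e]].

Definition Zbasis (n : nat) (B : set 'cV[int]_n) : Prop :=
  exists2 U : 'M[int]_n, B = range (fun j => col j U) &
    forall z : 'cV[int]_n, exists! a : 'cV[int]_n, U *m a = z.

Definition smooth (n : nat) (P : set 'cV[R]_n) : Prop :=
  [/\ simple_polytope P, rational_polytope P &
      forall v, vertex P v -> Zbasis (primitive_edge_vectors P v)].

(* For each facet F there is a primitive u_F such that u_F x <= 1 is valid on P
   with equality exactly on F, so that u_F is the exterior normal of F. *)
Definition reflexive (n : nat) (P : set 'cV[R]_n) : Prop :=
  [/\ lattice_polytope P, interior P 0 &
      forall F, facet P F -> exists u : 'rV[int]_n,
        [/\ primitive u, (forall x, P x -> dotp (toR u) x <= 1) &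
            F = [set x | P x /\ dotp (toR u) x = 1]]].

Definition monotone_polytope (n : nat) (P : set 'cV[R]_n) : Prop :=
  smooth P /\ reflexive P.

Definition polyhedron (m n : nat) (A : 'M[int]_(m, n)) (c : 'cV[int]_m) :
    set 'cV[R]_n :=
  [set x | forall i, dotp (toR (row i A)) x <= (c i 0)%:~R].

(* Irredundancy: dropping any single inequality changes the polyhedron. *)
Definition facet_description (m n : nat) (A : 'M[int]_(m, n)) (c : 'cV[int]_m)
    (P : set 'cV[R]_n) : Prop :=
  [/\ forall i, primitive (row i A),
      P = polyhedron A c &
      forall i, P <>
        [set x | forall j, j != i -> dotp (toR (row j A)) x <= (c j 0)%:~R]].

(* Meant for smooth lattice polytopes P, whose facet description exists and is
   unique up to reordering the rows. *)
Definition neat (n : nat) (P : set 'cV[R]_n) : Prop :=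
  forall (m : nat) (A : 'M[int]_(m, n)) (c : 'cV[int]_m),
    facet_description A c P ->
    forall b : 'cV[int]_m,
      normally_isomorphic (polyhedron A (c + b)) P ->
      normally_isomorphic (polyhedron A (c - b)) P ->
      polyhedron A (c + b) `&` [set - y | y in polyhedron A (c - b)]
        `&` @lattice n !=set0.

Definition oda_conjecture : Prop :=
  forall (n : nat) (P Q : set 'cV[R]_n),
    lattice_polytope P -> lattice_polytope Q -> smooth Q ->
    refines (normal_fan Q) (normal_fan P) ->
    minkowski_sum P Q `&` @lattice n =
    minkowski_sum (P `&` @lattice n) (Q `&` @lattice n).

End Polytopes.

(* Main.v *)
Require Import Defs.
From mathcomp Require Import all_boot all_order all_algebra.
From mathcomp Require Import all_classical all_reals.
From mathcomp Require Import topology normedtype.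
From mathcomp Require Import intdiv lra.
Import Order.TTheory GRing.Theory Num.Theory.
Import numFieldNormedType.Exports.
Local Open Scope classical_set_scope.
Local Open Scope card_scope.
Local Open Scope ring_scope.

(** Write P = {x | A x <= c} and, for an integer vector c', P' = {x | A x <=
    c'}. The Minkowski sum P_b + P_{-b} should be 2 P, because the three
    polytopes have the same normal fan and the right-hand sides c + b and c -
    b add up to 2 c. As 0 lies in P, it then lies in P_b + P_{-b}; Oda's
    conjecture splits it into lattice points p of P_b and q of P_{-b}, and p =
    - q is the point that neatness asks for. What has to be justified is that
    P_b and P_{-b} are lattice polytopes, that P_{-b} is smooth, and that 0 is
    in their sum.

    All three follow from a description of smooth polytopes by their corners.
    At a vertex v of a smooth polytope the primitive edge vectors are the
    columns of an integer matrix U with integer inverse W, and P sits inside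
    the cone v + U (R_+)^n and contains an initial piece of each of its
    generators ([unimodular_corner], [smooth_vertex_corner]). So the normal
    cone of v is generated by the rows of - W. Primitivity and irredundancy of
    the facet description force the rows of A that are tight at v to be
    exactly the rows of - W ([corner_facets]). If P' has the same normal fan,
    the normal cone of v is the normal cone of a single point w of P', and the
    same rows of A are tight at w, since otherwise P' could be prolonged
    beyond w in a direction forbidden by that cone ([corner_deformation]).
    Hence P' has the same corner at w as P has at v, and w is a lattice point
    because W is unimodular.

    Since the normal cones of the vertices of P cover the dual space,
    separating a point from a polytope shows that P' is the convex hull of
    these points w ([polytope_deformation]); so P' is a lattice polytope, and
    it is smooth because smoothness can be read off its corners
    ([smooth_of_corners]). Finally the tight equations at v give w_b + w_{-b}
    = 2 v, so a convex combination of the vertices of P that yields 0 also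
    yields 0 as an element of P_b + P_{-b}.

    The convex geometry rests on one theorem of the alternative, [gordan]. *)

(** * Linear functionals *)

Section Pairing.
Context {R : realType} {n : nat}.
Implicit Types (u : 'rV[R]_n) (x y : 'cV[R]_n).

Lemma dotpD u x y : dotp u (x + y) = dotp u x + dotp u y.
Proof. by rewrite /dotp mulmxDr mxE. Qed.

Lemma dotpZ u a x : dotp u (a *: x) = a * dotp u x.
Proof. by rewrite /dotp -scalemxAr mxE. Qed.

Lemma dotpN u x : dotp u (- x) = - dotp u x.
Proof. by rewrite /dotp mulmxN mxE. Qed.

Lemma dotpDl u u' x : dotp (u + u') x = dotp u x + dotp u' x.
Proof. by rewrite /dotp mulmxDl mxE. Qed.

Lemma dotpZl u a x : dotp (a *: u) x = a * dotp u x.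
Proof. by rewrite /dotp -scalemxAl mxE. Qed.

Lemma dotpNl u x : dotp (- u) x = - dotp u x.
Proof. by rewrite /dotp mulNmx mxE. Qed.

Lemma dotp0 u : dotp u 0 = 0.
Proof. by rewrite /dotp mulmx0 mxE. Qed.

Lemma dotp_col k u (V : 'M[R]_(n, k)) j : dotp u (col j V) = (u *m V) 0 j.
Proof. by rewrite /dotp colE mulmxA -colE mxE. Qed.

Lemma dotp_mulmx k u (V : 'M[R]_(n, k)) (w : 'cV[R]_k) :
  dotp u (V *m w) = \sum_j dotp u (col j V) * w j 0.
Proof.
by rewrite {1}/dotp mulmxA mxE; apply: eq_bigr => j _; rewrite dotp_col.
Qed.

Lemma dotp_tr_gt0 x : x != 0 -> 0 < dotp x^T x.
Proof.
move=> x0; have sqE : dotp x^T x = \sum_i x i 0 ^+ 2.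
  by rewrite /dotp mxE; apply: eq_bigr => i _; rewrite mxE.
rewrite lt_def sqE; apply/andP; split; last first.
  by apply: sumr_ge0 => i _; exact: sqr_ge0.
apply: contra x0; rewrite psumr_eq0 => [/allP xi0|i _]; last exact: sqr_ge0.
apply/eqP/matrixP => i j; rewrite ord1 mxE; apply/eqP.
by have := xi0 i (mem_index_enum i); rewrite sqrf_eq0.
Qed.

End Pairing.

(** Finitely many strict inequalities survive a small perturbation; this
    provides the step lengths in all the local arguments below. *)
Lemma small_perturbation (R : realType) (I : finType) (p q : I -> R) :
  (forall i, 0 < p i) -> exists2 e, 0 < e & forall i, 0 < p i + e * q i.
Proof.
move=> p0; pose s := \sum_i `|q i| / p i.
have t0 i : 0 <= `|q i| / p i by rewrite divr_ge0 // ltW.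
have s1 : 0 < 1 + s by rewrite ltr_pwDl // sumr_ge0.
exists (1 + s)^-1 => [|i]; first by rewrite invr_gt0.
have lts : `|q i| < (1 + s) * p i.
  rewrite -ltr_pdivrMr // /s (bigD1 i) //= addrCA ltrDl.
  by rewrite ltr_pwDl // sumr_ge0.
have : - ((1 + s)^-1 * q i) <= (1 + s)^-1 * `|q i|.
  by rewrite -mulrN ler_pM2l ?invr_gt0 // lerNl -normrN -lerNl ler_norm.
have : (1 + s)^-1 * `|q i| < p i by rewrite mulrC ltr_pdivrMr // mulrC.
lra.
Qed.

(** * Separation and vertices of convex hulls *)

Section ConvexHull.
Context {R : realType} {n : nat}.

Lemma conv_hull_col k (V : 'M[R]_(n, k)) j : conv_hull V (col j V).
Proof.
exists (delta_mx j 0); last by rewrite -colE.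
split=> [i|]; first by rewrite mxE; case: (_ && _).
by rewrite (bigD1 j) //= big1 ?addr0 => [|i ij]; rewrite !mxE ?eqxx ?(negPf ij).
Qed.

(** Spares [gordan] the normalisation of the weights that it finds. *)
Lemma conv_hull_cone k (V : 'M[R]_(n, k)) (w : 'cV[R]_k) :
  (forall i, 0 <= w i 0) -> 0 < \sum_i w i 0 -> V *m w = 0 -> conv_hull V 0.
Proof.
move=> w0 s0 Vw; exists ((\sum_i w i 0)^-1 *: w).
  split=> [i|]; first by rewrite mxE mulr_ge0 // invr_ge0 ltW.
  under eq_bigr do rewrite mxE.
  by rewrite -mulr_sumr mulVf // gt_eqF.
by rewrite -scalemxAr Vw scaler0.
Qed.

Lemma dotp_hull_le k (V : 'M[R]_(n, k)) u a :
  (forall j, dotp u (col j V) <= a) -> forall x, conv_hull V x -> dotp u x <= a.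
Proof.
move=> ua x [w [w0 w1] <-]; rewrite dotp_mulmx -[a]mulr1 -w1 mulr_sumr.
by apply: ler_sum => j _; apply: ler_wpM2r.
Qed.

(** A weighted mean of numbers [<= a] reaches [a] only if every number of
    positive weight equals [a]. *)
Lemma conv_hull_tight k (V : 'M[R]_(n, k)) (w : 'cV[R]_k) u a :
  (forall j, 0 <= w j 0) -> \sum_j w j 0 = 1 ->
  (forall j, dotp u (col j V) <= a) -> a <= dotp u (V *m w) ->
  forall j, w j 0 = 0 \/ dotp u (col j V) = a.
Proof.
move=> w0 w1 ua au j.
have terms0 i : 0 <= (a - dotp u (col i V)) * w i 0.
  by rewrite mulr_ge0 // subr_ge0.
have : \sum_i (a - dotp u (col i V)) * w i 0 == 0.
  rewrite eq_le sumr_ge0 // andbT; under eq_bigr do rewrite mulrBl.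
  by rewrite sumrB -mulr_sumr w1 mulr1 -dotp_mulmx subr_le0.
rewrite psumr_eq0 // => /allP /(_ j (mem_index_enum j)).
by rewrite mulf_eq0 subr_eq0 => /orP[/eqP ->|/eqP]; [right|left].
Qed.

Lemma conv_hull_sub k l (V : 'M[R]_(n, k)) (U : 'M[R]_(n, l)) :
  (forall j, conv_hull V (col j U)) -> conv_hull U `<=` conv_hull V.
Proof.
move=> UV x [w [w0 w1] <-].
have /choice [f fP] : forall j, exists a : 'cV[R]_k,
    [/\ forall i, 0 <= a i 0, \sum_i a i 0 = 1 & V *m a = col j U].
  by move=> j; have [a [a0 a1] e] := UV j; exists a.
pose F := \matrix_(i, j) f j i 0.
exists (F *m w).
  split=> [i|].
    rewrite mxE; apply: sumr_ge0 => j _; rewrite mxE.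
    by apply: mulr_ge0 => //; have [] := fP j.
  under eq_bigr do rewrite mxE.
  rewrite exchange_big -w1; apply: eq_bigr => j _.
  under eq_bigr do rewrite mxE.
  by rewrite -mulr_suml; have [_ -> _] := fP j; rewrite mul1r.
rewrite mulmxA; congr (_ *m w); apply/matrixP => i j.
have [_ _ /(congr1 (fun M : 'cV[R]_n => M i 0))] := fP j.
rewrite !mxE => <-.
by apply: eq_bigr => l' _; rewrite !mxE.
Qed.

(** Gordan's alternative, by induction on the number of columns. Split off the
    first column q and apply the induction hypothesis to the orthogonal
    projections of the others on the hyperplane q^T x = 0. A functional
    positive on the projections can be chosen to vanish at q, and tilting it
    slightly towards q^T makes it positive at q too. Otherwise a convex
    combination of the other columns is a multiple rho q: if rho <= 0 this is
    a combination that yields 0, and if rho > 0 then any functional positive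
    on the other columns is positive at q, so that the induction hypothesis
    for the other columns themselves concludes. *)
Lemma gordan k (H : 'M[R]_(n, k)) :
  (exists u, forall j, 0 < dotp u (col j H)) \/ conv_hull H 0.
Proof.
elim: k H => [|k IH] H; first by left; exists 0; case.
move: H; rewrite -[k.+1]/(1 + k)%N => H; rewrite -[H]hsubmxK.
move: (lsubmx H) (rsubmx H) => q {}H.
have colq j : col j (row_mx q H) =
    match fintype.split j with inl _ => q | inr j => col j H end.
  case: splitP => [i ji|i ji].
    have -> : j = lshift k i by apply: val_inj.
    by rewrite colKl ord1 col_id.
  have -> : j = rshift 1 i by apply: val_inj.
  by rewrite colKr.
have sumw (a : 'cV[R]_1) (w : 'cV[R]_k) :
    \sum_i (col_mx a w) i 0 = a 0 0 + \sum_i w i 0.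
  by rewrite big_split_ord big_ord1 col_mxEu; congr (_ + _);
     apply: eq_bigr => i _; rewrite col_mxEd.
have posw (a : 'cV[R]_1) (w : 'cV[R]_k) : 0 <= a 0 0 ->
    (forall i, 0 <= w i 0) -> forall i, 0 <= (col_mx a w) i 0.
  by move=> a0 w0 i; rewrite mxE; case: splitP => j _; rewrite ?ord1.
have [->|q0] := eqVneq q 0.
  right; exists (col_mx 1%:M 0).
    split; last by rewrite sumw big1 => [|i _]; rewrite !mxE ?addr0.
    by apply: posw => [|i]; rewrite !mxE.
  by rewrite mul_row_col mul0mx mulmx0 addr0.
pose N := dotp q^T q; have N0 : 0 < N by exact: dotp_tr_gt0.
pose r := N^-1 *: (q^T *m H).
have colr j : col j (H - q *m r) = col j H - (N^-1 * dotp q^T (col j H)) *: q.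
  apply/matrixP => i i'; rewrite dotp_col !mxE big_ord1 !mxE [q _ _ * _]mulrC.
  by rewrite [i']ord1.
have [[u uP]|[w [w0 w1] e]] := IH (H - q *m r).
  left; pose u' := u - (N^-1 * dotp u q) *: q^T.
  have u'q : dotp u' q = 0.
    rewrite /u' dotpDl dotpNl dotpZl -/N mulrAC mulVf ?gt_eqF // mul1r subrr //.
  have u'H j : 0 < dotp u' (col j H).
    have := uP j; rewrite colr dotpD dotpN dotpZ /u' dotpDl dotpNl dotpZl.
    by rewrite mulrAC.
  have [e e0 eP] :=
    small_perturbation _ _ _ (fun j => dotp q^T (col j H)) u'H.
  exists (u' + e *: q^T) => j; rewrite colq; case: fintype.split => [_|{}j].
    by rewrite dotpDl u'q dotpZl add0r mulr_gt0.
  by rewrite dotpDl dotpZl.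
pose rho := (r *m w) 0 0.
have Hw : H *m w = rho *: q.
  move/eqP: e; rewrite mulmxBl subr_eq0 => /eqP ->.
  by rewrite -mulmxA [r *m w]mx11_scalar mul_mx_scalar.
have [rho0|rho0] := leP rho 0.
  right; apply: (@conv_hull_cone _ _ (col_mx (- rho)%:M w)).
  - by apply: posw => //; rewrite mxE oppr_ge0.
  - by rewrite sumw w1 mxE mulr1n; lra.
  by rewrite mul_row_col Hw mul_mx_scalar scaleNr addNr.
have [[u uP]|[a [a0 a1] e']] := IH H.
  left; exists u => j; rewrite colq; case: fintype.split => [_|{}j //].
  rewrite -(pmulr_rgt0 _ rho0) -dotpZ -Hw dotp_mulmx.
  rewrite lt_def sumr_ge0 ?andbT => [|i _]; last by rewrite mulr_ge0 // ltW.
  rewrite psumr_eq0 => [|i _]; last by rewrite mulr_ge0 // ltW.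
  apply/negP => /allP z; have : \sum_i w i 0 = 0.
    rewrite big1 // => i _; have := z i (mem_index_enum i).
    by rewrite mulf_eq0 gt_eqF //= => /eqP.
  by rewrite w1 => /eqP; rewrite oner_eq0.
right; exists (col_mx 0 a).
  by split; [apply: posw => //; rewrite mxE|rewrite sumw a1 mxE add0r].
by rewrite mul_row_col mulmx0 add0r.
Qed.

(** Gordan's alternative for the differences between [x] and the columns. *)
Lemma separation k (V : 'M[R]_(n, k)) x :
  ~ conv_hull V x -> exists u, forall j, dotp u (col j V) < dotp u x.
Proof.
move=> Vx; pose H := \matrix_(i < n, j < k) (x i 0 - V i j).
have colH j : col j H = x - col j V by apply/matrixP => i l; rewrite ord1 !mxE.
have [[u uP]|[w [w0 w1] e]] := gordan _ H.
  by exists u => j; have := uP j; rewrite colH dotpD dotpN subr_gt0.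
case: Vx; exists w => //; apply/matrixP => i l; rewrite ord1.
move/matrixP/(_ i 0)/eqP: e; rewrite !mxE.
under eq_bigr do rewrite mxE mulrBl.
by rewrite sumrB -mulr_sumr w1 mulr1 subr_eq0 => /eqP.
Qed.

Lemma conv_hull_vertex_col k (V : 'M[R]_(n, k)) x :
  vertex (conv_hull V) x -> exists j, x = col j V.
Proof.
move=> [_ [u uE]].
have [[w [w0 w1] xE] xmax] : max_face (conv_hull V) u x by rewrite -uE.
have [j wj] : exists j, 0 < w j 0.
  apply: contrapT => nw; have : \sum_i w i 0 = 0.
    rewrite big1 // => i _; apply/eqP; rewrite eq_le w0 andbT leNgt.
    by apply/negP => wi; apply: nw; exists i.
  by rewrite w1 => /eqP; rewrite oner_eq0.
exists j; symmetry; suff : [set x] (col j V) by [].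
have Vmax i : dotp u (col i V) <= dotp u x by apply: xmax; exact: conv_hull_col.
rewrite uE; split=> [|y Vy]; first exact: conv_hull_col.
apply: le_trans (xmax _ Vy) _.
have [wj0|->//] := conv_hull_tight _ _ _ _ _ w0 w1 Vmax ltac:(by rewrite xE) j.
by rewrite wj0 ltxx in wj.
Qed.

(** Columns lying in the convex hull of the others can be dropped; once none
    is left, separating a column from the others exposes it as a vertex. *)
Lemma polytope_vertices (P : set 'cV[R]_n) : polytope P ->
  exists k (V : 'M[R]_(n, k)), P = conv_hull V /\ forall j, vertex P (col j V).
Proof.
move=> [k]; elim: k => [|k IH] [V PV].
  by exists 0%N, V; split=> //; case.
have [[j jV]|nV] := pselect (exists j, conv_hull (col' j V) (col j V)).
  apply: IH; exists (col' j V); rewrite PV; apply/seteqP.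
  split; apply: conv_hull_sub => i.
    have [l ->|->] := unliftP j i => //.
    suff -> : col (lift j l) V = col l (col' j V) by exact: conv_hull_col.
    by apply/matrixP => a b; rewrite !mxE.
  suff -> : col i (col' j V) = col (lift j i) V by exact: conv_hull_col.
  by apply/matrixP => a b; rewrite !mxE.
exists k.+1, V; split=> // j; rewrite PV; split; first by exists (col j V).
have [u uP] : exists u, forall i, dotp u (col i (col' j V)) < dotp u (col j V).
  by apply: separation => jV; apply: nV; exists j.
have le_u i : i != j -> dotp u (col i V) < dotp u (col j V).
  case: (unliftP j i) => [l ->|->]; last by rewrite eqxx.
  suff -> : col (lift j l) V = col l (col' j V) by [].
  by apply/matrixP => a b; rewrite !mxE.
have max_j : forall x, conv_hull V x -> dotp u x <= dotp u (col j V).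
  by apply: dotp_hull_le => i; have [->|/le_u/ltW] := eqVneq i j.
exists u; apply/seteqP; split=> [_ ->|x [[w [w0 w1] <-] xmax]].
  by split; [exact: conv_hull_col|exact: max_j].
have Vmax i : dotp u (col i V) <= dotp u (col j V).
  by apply: max_j; exact: conv_hull_col.
have wi i : i != j -> w i 0 = 0.
  have [|//|/eqP ui /le_u] := conv_hull_tight _ _ _ _ _ w0 w1 Vmax _ i.
    by apply: xmax; exact: conv_hull_col.
  by rewrite (eqP ui) ltxx.
have wj : w j 0 = 1 by rewrite -w1 (bigD1 j) //= big1 ?addr0.
suff -> : w = delta_mx j 0 by rewrite -colE.
apply/matrixP => i l; rewrite ord1 mxE eqxx andbT.
by have [->|/wi] := eqVneq i j.
Qed.

End ConvexHull.

(** * Unimodular corners and their edges *)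

Section UnimodularCorner.
Context {R : realType} {n : nat}.
Implicit Types (P S E : set 'cV[R]_n) (U W : 'M[int]_n) (v x : 'cV[R]_n).

Lemma has_dim1P S w : S w ->
  has_dim S 1 <-> exists x, [/\ S x, x != w &
    forall y, S y -> exists t, y - w = t *: (x - w)].
Proof.
move=> Sw; split=> [[_ [V VP dimV]]|[x [Sx xw xP]]].
  have [x [Sx xw]] : exists x, S x /\ x != w.
    apply: contrapT => nx; have Sw1 x : S x -> x = w.
      by move=> Sx; apply: contrapT => /eqP xw; apply: nx; exists x.
    have : (V <= 0)%VS.
      by apply/VP => x y /Sw1 -> /Sw1 ->; rewrite subrr mem0v.
    by rewrite subv0 => /eqP V0; rewrite V0 dimv0 in dimV.
  have VS y : S y -> y - w \in V by move=> Sy; apply: (VP V).1.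
  exists x; split=> // y /VS yV; apply/vlineP.
  suff -> : <[x - w]>%VS = V by [].
  apply/eqP; rewrite eqEdim -memvE VS //= dimV dim_vline subr_eq0 xw //.
split; first by exists w.
exists <[x - w]>%VS; last by rewrite dim_vline subr_eq0 xw.
move=> W; rewrite -memvE; split=> [xwW y z Sy Sz|WS]; last exact: WS.
have -> : y - z = (y - w) - (z - w) by rewrite opprB addrA subrK.
have [[s ->] [t ->]] := (xP _ Sy, xP _ Sz).
by apply: memvB; apply: memvZ.
Qed.

(** For convex P this says that the tangent cone at v is v + U (R_+)^n. The
    rows of W, the inverse of U, are the coordinate functionals in the basis
    U. Only points of P on the generators of the cone are required, because
    these are what the edges of a smooth polytope provide. *)
Definition unimodular_corner P v U W : Prop :=
  [/\ W *m U = 1%:M, P v,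
      forall x, P x -> forall k, 0 <= dotp (row k (toR R W)) (x - v) &
      forall k, exists2 e : R, 0 < e & P (v + e *: col k (toR R U))].

Section Coordinates.
Variables U W : 'M[int]_n.
Hypothesis WU : W *m U = 1%:M.

Lemma toR_inv : toR R W *m toR R U = 1%:M.
Proof. by rewrite -map_mxM WU map_mx1. Qed.

Lemma dual_basis k l : dotp (row k (toR R W)) (col l (toR R U)) = (k == l)%:R.
Proof. by rewrite dotp_col -row_mul toR_inv !mxE. Qed.

Lemma basis_expansion x :
  x = \sum_k dotp (row k (toR R W)) x *: col k (toR R U).
Proof.
rewrite -{1}[x]mul1mx -(mulmx1C toR_inv) -mulmxA.
apply/matrixP => i j; rewrite ord1 mxE summxE; apply: eq_bigr => k _.
by rewrite [RHS]mxE [LHS]mulrC /dotp -row_mul !mxE.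
Qed.

Lemma coordinates_inj x y :
  (forall k, dotp (row k (toR R W)) x = dotp (row k (toR R W)) y) -> x = y.
Proof.
move=> xy; rewrite (basis_expansion x) (basis_expansion y).
by apply: eq_bigr => k _; rewrite xy.
Qed.

Lemma dotp_expansion u x :
  dotp u x = \sum_k dotp (row k (toR R W)) x * dotp u (col k (toR R U)).
Proof.
rewrite {1}(basis_expansion x) /dotp mulmx_sumr summxE.
by apply: eq_bigr => k _; exact: dotpZ.
Qed.

Lemma primitive_col k : primitive (col k U).
Proof.
move=> d dU; apply/eqP; rewrite -dvdn1.
have -> : 1%N = `|(1%:M : 'M[int]_n) k k|%N by rewrite mxE eqxx.
rewrite -WU mxE -[d]absz_nat -dvdzE; apply: rpred_sum => l _; apply: dvdz_mull.
by have := dU l 0; rewrite mxE.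
Qed.

(** Two primitive vectors on the same ray are equal. The coordinates of [e] in
    the basis [U] all vanish except the one of index [k], which divides all
    the entries of [e]. *)
Lemma primitive_in_ray (e : 'cV[int]_n) k (s t : R) :
  0 < s -> 0 <= t -> primitive e ->
  s *: col k (toR R U) = t *: toR R e -> e = col k U.
Proof.
move=> s0 t0 prim_e ray; pose z := W *m e.
have eE : e = U *m z by rewrite mulmxA (mulmx1C WU) mul1mx.
have zE l : t * (z l 0)%:~R = s * (k == l)%:R.
  have := congr1 (dotp (row l (toR R W))) ray.
  rewrite !dotpZ dual_basis eq_sym => ->; congr (_ * _).
  by rewrite /dotp -row_mul -map_mxM !mxE.
clearbody z; have tz : 0 < t * (z k 0)%:~R by rewrite zE eqxx mulr1.
have tn0 : t != 0 by apply: contraTneq tz => ->; rewrite mul0r ltxx.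
have zk : 0 < z k 0.
  by rewrite -(ltr0z R) -(pmulr_rgt0 _ (_ : 0 < t)) // lt_def tn0.
have zd : z = z k 0 *: delta_mx k 0.
  apply/matrixP => l j; rewrite ord1 !mxE eqxx andbT.
  have [->|lk] := eqVneq l k; first by rewrite mulr1.
  have /eqP := zE l; rewrite [k == l]eq_sym (negPf lk) mulr0 mulf_eq0 (negPf tn0).
  by rewrite intr_eq0 mulr0 => /eqP.
have eZ : e = z k 0 *: col k U by rewrite eE {1}zd -scalemxAr -colE.
have : absz (z k 0) = 1%N.
  by apply: prim_e => i j; rewrite eZ mxE abszM dvdn_mulr.
by move=> z1; rewrite eZ -(gtz0_abs zk) z1 scale1r.
Qed.

End Coordinates.

Definition ray_section P v (d : 'cV[R]_n) : set 'cV[R]_n :=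
  [set x | P x /\ exists t, x = v + t *: d].

Section Corner.
Variables (P : set 'cV[R]_n) (v : 'cV[R]_n) (U W : 'M[int]_n).
Hypothesis cornerP : unimodular_corner P v U W.

Let WU : W *m U = 1%:M. Proof. by case: cornerP. Qed.

(** The normal cone of a corner is polar to the tangent cone. *)
Lemma corner_normal_cone u :
  max_face P u v <-> forall k, dotp u (col k (toR R U)) <= 0.
Proof.
have [_ Pv Wpos Ufeas] := cornerP; split=> [[_ umax] k|uU].
  have [e e0 /umax] := Ufeas k.
  by rewrite dotpD dotpZ gerDl pmulr_rle0.
split=> // x Px; rewrite -subr_le0 -dotpN -dotpD (dotp_expansion _ _ WU).
by apply: sumr_le0 => k _; rewrite mulr_ge0_le0 // Wpos.
Qed.

(** The edge along a generator is exposed by minus the sum of the other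
    coordinate functionals. *)
Lemma corner_ray_edge k :
  edge P (ray_section P v (col k (toR R U))) /\
  ray_section P v (col k (toR R U)) v.
Proof.
have [_ Pv Wpos Ufeas] := cornerP; set d := col k _.
have rv : ray_section P v d v by split=> //; exists 0; rewrite scale0r addr0.
split=> //; split; last first.
  apply/(has_dim1P _ v) => //; have [e e0 Pe] := Ufeas k.
  exists (v + e *: d); split; first by split=> //; exists e.
    rewrite -subr_eq0 addrC addKr; apply/negP => /eqP ed0.
    have := congr1 (dotp (row k (toR R W))) ed0.
    by rewrite dotpZ dual_basis // eqxx mulr1 dotp0 => /eqP; rewrite gt_eqF.
  move=> y [_ [t ->]]; exists (t / e).
  by rewrite ![v + _ - v]addrC !addKr scalerA divfK ?gt_eqF.
split; first by exists v.
(* on the tangent cone [u] is nonpositive and vanishes only on the k-th ray *)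
pose u := - \sum_(l | l != k) row l (toR R W).
have uE x : dotp u x = - \sum_(l | l != k) dotp (row l (toR R W)) x.
  by rewrite dotpNl /dotp mulmx_suml summxE.
have ud : dotp u d = 0.
  by rewrite uE big1 ?oppr0 // => l lk; rewrite dual_basis // (negPf lk).
have umax x : P x -> dotp u x <= dotp u v.
  move=> Px; rewrite -subr_le0 -dotpN -dotpD uE oppr_le0.
  by apply: sumr_ge0 => l _; exact: Wpos.
exists u; apply/seteqP; split=> x.
  move=> [Px [t xE]]; split=> // y /umax.
  by rewrite xE dotpD dotpZ ud mulr0 addr0.
move=> [Px xmax]; split=> //; exists (dotp (row k (toR R W)) (x - v)).
have : dotp u (x - v) = 0.
  by rewrite dotpD dotpN; apply/eqP; rewrite subr_eq0 eq_le umax // xmax.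
rewrite uE => /eqP; rewrite oppr_eq0 psumr_eq0 => [/allP z|l _]; last exact: Wpos.
rewrite -[LHS](subrK v) addrC; congr (_ + _).
rewrite {1}(basis_expansion _ _ WU (x - v)) (bigD1 k) //= big1 ?addr0 // => l lk.
by have := z l (mem_index_enum l); rewrite lk => /eqP ->; rewrite scale0r.
Qed.

(** If [u] exposes an edge at [v], a second point of the edge has a positive
    coordinate along some generator [k], and then [u] vanishes on this
    generator, since it is nonpositive on all of them and constant on the
    edge. So the edge contains the initial piece of the k-th ray, and having
    dimension one it lies on its line. *)
Lemma corner_edge_ray E : edge P E -> E v ->
  exists k, E = ray_section P v (col k (toR R U)).
Proof.
have [_ Pv Wpos Ufeas] := cornerP => -[[_ [u Eu]] E1] Ev.
have [x [Ex xv xP]] := (has_dim1P _ _ Ev).1 E1.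
have [_ vmax] : max_face P u v by rewrite -Eu.
have uU : forall k, dotp u (col k (toR R U)) <= 0.
  by apply/corner_normal_cone; rewrite -Eu.
have [Px xmax] : max_face P u x by rewrite -Eu.
have [k [xk uk]] : exists k, dotp (row k (toR R W)) (x - v) != 0 /\
    dotp u (col k (toR R U)) = 0.
  have : dotp u (x - v) = 0.
    by rewrite dotpD dotpN; apply/eqP; rewrite subr_eq0 eq_le vmax // xmax.
  rewrite (dotp_expansion _ _ WU) => /eqP.
  rewrite -oppr_eq0 -sumrN psumr_eq0 => [/allP z|k _]; last first.
    by rewrite oppr_ge0 mulr_ge0_le0 // Wpos.
  apply: contrapT => nk; move/eqP: xv; apply.
  apply/eqP; rewrite -subr_eq0; apply/eqP.
  apply: (coordinates_inj _ _ WU) => k; rewrite dotp0; apply/eqP.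
  apply: contrapT => /negP xk; apply: nk; exists k; split=> //.
  have := z k (mem_index_enum k).
  by rewrite oppr_eq0 mulf_eq0 (negPf xk) => /eqP.
have [e e0 Pe] := Ufeas k.
have Ee : E (v + e *: col k (toR R U)).
  rewrite Eu; split=> // y /vmax.
  by rewrite dotpD dotpZ uk mulr0 addr0.
exists k; apply/seteqP; split=> y; last first.
  move=> [Py [t yE]]; rewrite Eu; split=> // z /vmax.
  by rewrite yE dotpD dotpZ uk mulr0 addr0.
move=> Ey; have [Py _] : max_face P u y by rewrite -Eu.
split=> //; have [s sE] := xP _ Ee; have [t tE] := xP _ Ey.
have s0 : s != 0.
  apply: contraTneq e0 => s0; rewrite s0 scale0r addrC addKr in sE.
  have := congr1 (dotp (row k (toR R W))) sE.
  by rewrite dotpZ dual_basis // eqxx mulr1 dotp0 => ->; rewrite ltxx.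
exists (t / s * e); rewrite -scalerA.
have <- : v + e *: col k (toR R U) - v = e *: col k (toR R U).
  by rewrite addrC addKr.
by rewrite sE scalerA divfK // -tE addrC subrK.
Qed.

Lemma corner_edge_direction k :
  edge_direction v (ray_section P v (col k (toR R U))) (col k U).
Proof.
have [_ _ Wpos _] := cornerP => x [/Wpos /(_ k) xk [t xE]].
exists t; last by rewrite xE /toR map_col.
by move: xk; rewrite xE addrC addKr dotpZ dual_basis // eqxx mulr1.
Qed.

Lemma corner_edges_card : [set E | edge P E /\ E v] #= `I_n.
Proof.
have [_ _ _ Ufeas] := cornerP.
have -> : [set E | edge P E /\ E v] =
    [set ray_section P v (col k (toR R U)) | k in [set: 'I_n]].
  apply/seteqP; split=> [E [eE Ev]|_ [k _ <-]]; last exact: corner_ray_edge.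
  by have [k ->] := corner_edge_ray _ eE Ev; exists k.
have -> : `I_n = [set nat_of_ord k | k in [set: 'I_n]].
  by apply/seteqP; split=> [i ltin|_ [k _ <-]] /=; [exists (Ordinal ltin)|].
apply: (card_eq_trans (inj_card_eq _)); last first.
  by rewrite card_eq_sym; apply: inj_card_eq => i j _ _; exact: val_inj.
move=> k l _ _ kl; have [e e0 Pe] := Ufeas k.
have : ray_section P v (col k (toR R U)) (v + e *: col k (toR R U)).
  by split=> //; exists e.
rewrite kl => -[_ [t /addrI /(congr1 (dotp (row k (toR R W))))]].
rewrite !dotpZ !dual_basis // eqxx mulr1; case: eqVneq => // _ eE.
by rewrite eE mulr0 ltxx in e0.
Qed.

Lemma corner_primitive_edge_vectors :
  primitive_edge_vectors P v = range (fun k => col k U).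
Proof.
have [_ _ _ Ufeas] := cornerP.
apply/seteqP; split=> [e [prim_e [E [eE Ev dirE]]]|_ [k _ <-]].
  have [k Ek] := corner_edge_ray _ eE Ev; exists k => //.
  have [s s0 Ps] := Ufeas k.
  have [|t t0 /addrI st] := dirE (v + s *: col k (toR R U)).
    by rewrite Ek; split=> //; exists s.
  by rewrite (primitive_in_ray _ _ WU _ _ _ _ s0 t0 prim_e st).
split; first exact: (primitive_col _ _ WU).
have [edgek rv] := corner_ray_edge k.
exists (ray_section P v (col k (toR R U))); split=> //.
exact: corner_edge_direction.
Qed.

Lemma corner_has_dim : has_dim P n.
Proof.
have [_ Pv _ Ufeas] := cornerP; split; first by exists v.
exists fullv => [W'|]; last by rewrite dimvf /dim /= muln1.
split=> [/subvP sub x y _ _|PW]; first by rewrite sub ?memvf.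
apply/subvP => x _; rewrite (basis_expansion _ _ WU x).
apply: memv_suml => k _; apply: memvZ.
have [e e0 Pe] := Ufeas k; have := PW _ _ Pe Pv.
rewrite addrC addKr => /(memvZ e^-1).
by rewrite scalerA mulVf ?gt_eqF // scale1r.
Qed.

End Corner.

(** A corner spans the whole space, and the other conditions defining
    smoothness speak of the edges at a vertex, which are the rays of the
    corner. *)
Lemma smooth_of_corners P : polytope P -> P !=set0 ->
  (forall v, vertex P v -> exists U W, unimodular_corner P v U W) -> smooth P.
Proof.
move=> polyP [x0 Px0] corners; split.
- split=> // [|v /corners [U [W corner]]]; last exact: corner_edges_card corner.
  have [k [V [PV Vvert]]] := polytope_vertices _ polyP.
  have [j _] : exists j : 'I_k, true.
    case: k V PV {Vvert} => [V PV|k V _]; last by exists ord0.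
    move: Px0; rewrite PV => -[w [_ /eqP]].
    by rewrite big_ord0 eq_sym oner_eq0.
  have [U [W corner]] := corners _ (Vvert j).
  exact: corner_has_dim corner.
- split=> // v E /corners [U [W corner]] eE Ev.
  have [k ->] := corner_edge_ray _ _ _ _ corner _ eE Ev.
  by exists (col k U); exact: (corner_edge_direction _ _ _ _ corner).
move=> v /corners [U [W corner]]; exists U.
  exact: (corner_primitive_edge_vectors _ _ _ _ corner).
have [WU _ _ _] := corner.
move=> z; exists (W *m z); split; first by rewrite mulmxA (mulmx1C WU) mul1mx.
by move=> a <-; rewrite mulmxA WU mul1mx.
Qed.

End UnimodularCorner.

(** * Vertices of smooth polytopes are unimodular corners *)

Lemma primitive_part (n : nat) (e : 'cV[int]_n) : e != 0 ->
  exists d e', [/\ (0 < d)%N, primitive e' & e = (d%:Z)%R *: e'].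
Proof.
move=> e0; pose d := \big[gcdn/0%N]_i absz (e i 0).
have de i : dvdn d (absz (e i 0)).
  by have /dvdn_biggcdP := dvdnn d; apply.
have d0 : (0 < d)%N.
  rewrite lt0n; apply: contra e0 => /eqP d0; apply/eqP/matrixP => i j.
  rewrite ord1 mxE; have := de i; rewrite d0 dvd0n absz_eq0.
  by move/eqP.
pose e' := \col_i divz (e i 0) d.
have eE i : e i 0 = (d%:Z)%R * e' i 0.
  by rewrite mxE mulrC divzK // dvdzE absz_nat.
exists d, e'; split=> // [f fe|]; last first.
  by apply/matrixP => i j; rewrite ord1 eE !mxE.
have : (d * f %| d)%N.
  by apply/dvdn_biggcdP => i _; rewrite eE abszM absz_nat dvdn_mul.
by rewrite -{2}[d]muln1 dvdn_pmul2l // dvdn1 => /eqP.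
Qed.

Section SmoothVertex.
Context {R : realType} {n : nat}.

Lemma conv_hull_shift k (V : 'M[R]_(n, k)) (w : 'cV[R]_k) (v : 'cV[R]_n) :
  \sum_j w j 0 = 1 -> V *m w - v = \sum_j w j 0 *: (col j V - v).
Proof.
move=> w1; under eq_bigr do rewrite scalerBr.
rewrite sumrB -scaler_suml w1 scale1r; congr (_ - _).
apply/matrixP => i l; rewrite ord1 mxE summxE.
by apply: eq_bigr => j _; rewrite !mxE mulrC.
Qed.

Lemma Zbasis_inverse (B : set 'cV[int]_n) : Zbasis B ->
  exists U W : 'M[int]_n, W *m U = 1%:M /\ B = range (fun k => col k U).
Proof.
move=> [U BU Uinv].
have /choice [f fP] : forall k : 'I_n, exists a : 'cV[int]_n,
    U *m a = delta_mx k 0.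
  by move=> k; have [a [aE _]] := Uinv (delta_mx k 0); exists a.
exists U, (\matrix_(i, j) f j i 0); split=> //; apply: mulmx1C.
apply/matrixP => i j; have /matrixP/(_ i 0) := fP j.
rewrite !mxE eqxx andbT => <-.
by apply: eq_bigr => k _; rewrite !mxE.
Qed.

(** A face is an edge at [v] as soon as the columns on it all lie on one line
    through [v] and are not all equal to [v]. *)
Lemma exposed_edge k (V : 'M[R]_(n, k)) v u j0 :
  conv_hull V v -> (forall j, dotp u (col j V) <= dotp u v) ->
  dotp u (col j0 V) = dotp u v -> col j0 V != v ->
  (forall j, dotp u (col j V) = dotp u v ->
     exists t, col j V - v = t *: (col j0 V - v)) ->
  [/\ edge (conv_hull V) (max_face (conv_hull V) u),
      max_face (conv_hull V) u v & max_face (conv_hull V) u (col j0 V)].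
Proof.
move=> Vv uV uj0 j0v tight; set E := max_face _ u.
have Ev : E v by split=> // y; exact: dotp_hull_le.
have Ej0 : E (col j0 V).
  by split=> [|y]; rewrite ?uj0; [exact: conv_hull_col|exact: dotp_hull_le].
split=> //; split; first by split; [exists v|exists u].
apply/(has_dim1P _ v) => //; exists (col j0 V); split=> // y [[w [w0 w1] <-] ymax].
have := conv_hull_tight _ _ _ _ _ w0 w1 uV (ymax _ Vv) => tightw.
have /choice [t tE] : forall j, exists t,
    w j 0 *: (col j V - v) = t *: (col j0 V - v).
  move=> j; have [->|/tight [t ->]] := tightw j; last first.
    by exists (w j 0 * t); rewrite scalerA.
  by exists 0; rewrite !scale0r.
exists (\sum_j t j); rewrite (conv_hull_shift _ _ _ _ w1) scaler_suml.
by apply: eq_bigr => j _.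
Qed.

(** The section of the tangent cone at [v] by the hyperplane u0 = -1, where
    [u0] exposes [v]: its points represent the directions from [v] to the
    other columns, up to positive factors. *)
Lemma vertex_figure k (V : 'M[R]_(n, k)) v : vertex (conv_hull V) v ->
  exists u0 (q : nat) (G : 'M[R]_(n, q)),
    [/\ forall l, dotp u0 (col l G) = -1,
        forall l, exists j, exists2 c : R, 0 < c & col j V - v = c *: col l G &
        forall j, col j V != v ->
          exists l, exists2 c : R, 0 < c & col j V - v = c *: col l G].
Proof.
move=> [_ [u0 u0E]]; pose A := [set j | col j V != v]%SET.
have [Vv vmax] : max_face (conv_hull V) u0 v by rewrite -u0E.
pose c j := dotp u0 (v - col j V).
have c0 j : col j V != v -> 0 < c j.
  move=> jv; rewrite /c dotpD dotpN subr_gt0 lt_def vmax; last exact: conv_hull_col.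
  rewrite andbT; apply: contra jv => /eqP jE; apply/eqP.
  suff : [set v] (col j V) by [].
  by rewrite u0E; split=> [|y /vmax]; [exact: conv_hull_col|rewrite jE].
pose G := \matrix_(i < n, l < #|A|) ((c (enum_val l))^-1 * (col (enum_val l) V - v) i 0).
have colG l : col l G = (c (enum_val l))^-1 *: (col (enum_val l) V - v).
  by apply/matrixP => i i'; rewrite ord1 !mxE.
have cA l : 0 < c (@enum_val _ (mem A) l).
  by apply: c0; have := enum_valP l; rewrite inE.
exists u0, #|A|, G; split=> [l|l|j jv].
- rewrite colG dotpZ -[_ - v]opprB dotpN -/(c _) mulrN mulVf //.
  by rewrite gt_eqF.
- exists (enum_val l), (c (enum_val l)) => //.
  by rewrite colG scalerA divff ?scale1r // gt_eqF.
have jA : j \in A by rewrite inE.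
exists (enum_rank_in jA j), (c j); first exact: c0.
by rewrite colG enum_rankK_in // scalerA divff ?scale1r // gt_eqF // c0.
Qed.

(** The edges at [v] generate the tangent cone: a vertex [g] of the vertex
    figure is exposed by some functional, and adding a multiple of [u0] turns
    it into a functional vanishing at [g], hence exposing an edge of [P] at
    [v] in the direction [g]. Rationality provides a primitive vector on this
    edge, which by smoothness is a column of [U]. So all the vertices of the
    vertex figure lie in the cone generated by [U], and then so does
    [P - v]. *)
Lemma smooth_vertex_corner (P : set 'cV[R]_n) v : smooth P -> vertex P v ->
  exists U W, unimodular_corner P v U W.
Proof.
move=> [[[k [V PV]] _ _] [_ rat] basis] vP.
have [U [W [WU edgesU]]] := Zbasis_inverse _ (basis v vP).
exists U, W.
have Pv : P v by have [_ [u vE]] := vP; have [] : max_face P u v by rewrite -vE.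
have Ufeas j : exists2 e : R, 0 < e & P (v + e *: col j (toR R U)).
  have [_ [E [[[_ [u Eu]] E1] Ev dirE]]] :
      primitive_edge_vectors P v (col j U) by rewrite edgesU; exists j.
  have [x [Ex xv _]] := (has_dim1P _ _ Ev).1 E1.
  have [t t0 xE] := dirE _ Ex; exists t.
    rewrite lt_def t0 andbT; apply: contra xv => /eqP t_0.
    by rewrite xE t_0 scale0r addr0.
  have [Px _] : max_face P u x by rewrite -Eu.
  by rewrite xE /toR map_col in Px.
have [u0 [q [G [u0G GV VG]]]] : exists u0 (q : nat) (G : 'M[R]_(n, q)),
    [/\ forall l, dotp u0 (col l G) = -1,
        forall l, exists j, exists2 c : R, 0 < c & col j V - v = c *: col l G &
        forall j, col j V != v ->
          exists l, exists2 c : R, 0 < c & col j V - v = c *: col l G].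
  by apply: vertex_figure; rewrite -PV.
have Gpos g : vertex (conv_hull G) g -> forall l, 0 <= dotp (row l (toR R W)) g.
  move=> gvert; have [l0 gE] := conv_hull_vertex_col _ _ _ gvert.
  have [_ [u uE]] := gvert; pose u' := u + dotp u g *: u0.
  have [_ gmax] : max_face (conv_hull G) u g by rewrite -uE.
  have u'G l : dotp u' (col l G) = dotp u (col l G) - dotp u g.
    by rewrite dotpDl dotpZl u0G mulrN1.
  have u'G_le0 l : dotp u' (col l G) <= 0.
    by rewrite u'G subr_le0 gmax //; exact: conv_hull_col.
  have u'G_eq0 l : dotp u' (col l G) = 0 -> col l G = g.
    move/eqP; rewrite u'G subr_eq0 => /eqP ug; suff : [set g] (col l G) by [].
    by rewrite uE; split=> [|y /gmax]; [exact: conv_hull_col|rewrite ug].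
  have [j0 [c0 c0_gt0 j0E]] := GV l0; rewrite -gE in j0E.
  have u'V j : dotp u' (col j V) = dotp u' v + dotp u' (col j V - v).
    by rewrite -dotpD addrC subrK.
  have g0 : g != 0.
    apply/eqP => g0; have := u0G l0; rewrite -gE g0 dotp0 => /eqP.
    by rewrite eq_sym oppr_eq0 oner_eq0.
  have j0v : col j0 V != v.
    by rewrite -subr_eq0 j0E scaler_eq0 negb_or g0 gt_eqF.
  have u'g : dotp u' g = 0 by rewrite gE u'G -gE subrr.
  have [|||||eE Ev Ej0] := exposed_edge _ V v u' j0.
  - by rewrite -PV.
  - move=> j; rewrite u'V gerDl.
    have [->|/VG [l [c c_gt0 ->]]] := eqVneq (col j V) v.
      by rewrite subrr dotp0.
    by rewrite dotpZ pmulr_rle0.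
  - by rewrite u'V j0E dotpZ u'g mulr0 addr0.
  - by [].
  - move=> j; rewrite u'V => /eqP; rewrite -subr_eq0 addrC addKr => /eqP.
    have [->|/VG [l [c c_gt0 ->]]] := eqVneq (col j V) v.
      by exists 0; rewrite subrr scale0r.
    rewrite dotpZ => /eqP; rewrite mulf_eq0 gt_eqF //= => /eqP /u'G_eq0 ->.
    by exists (c / c0); rewrite j0E scalerA divfK ?gt_eqF.
  rewrite -PV in eE Ev Ej0.
  have [e dirE] := rat _ _ vP eE Ev.
  have [t t0 tE] := dirE _ Ej0.
  have e0 : e != 0.
    by apply: contra j0v => /eqP e0; rewrite tE e0 /toR map_mx0 scaler0 addr0.
  have [d [e' [d0 prim_e' eE']]] := primitive_part _ _ e0.
  have [l1 _ l1E] : range (fun j => col j U) e'.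
    rewrite -edgesU; split=> //; exists (max_face P u'); split=> // x.
    move=> /dirE [s s0 ->]; exists (s * d%:R); first by rewrite mulr_ge0.
    by rewrite eE' /toR map_mxZ /= scalerA.
  move=> l; rewrite -(pmulr_rge0 _ c0_gt0) -dotpZ -j0E tE addrC addKr.
  rewrite eE' -l1E /toR map_mxZ map_col /= !dotpZ dual_basis //.
  by rewrite !mulr_ge0 // ler0z.
split=> // x Px l.
have Gl : forall y, conv_hull G y -> dotp (- row l (toR R W)) y <= 0.
  have [r [G' [GG' vert']]] : exists r (G' : 'M[R]_(n, r)),
      conv_hull G = conv_hull G' /\ forall j, vertex (conv_hull G) (col j G').
    by apply: polytope_vertices; exists q, G.
  rewrite GG'; apply: dotp_hull_le => j.
  by rewrite dotpNl oppr_le0; exact: Gpos.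
rewrite -oppr_le0 -dotpNl dotpD dotpN subr_le0.
move: x Px; rewrite PV; apply: dotp_hull_le => j.
rewrite -subr_le0 -dotpN -dotpD.
have [->|/VG [l' [c c_gt0 ->]]] := eqVneq (col j V) v.
  by rewrite subrr dotp0.
by rewrite dotpZ pmulr_rle0 // Gl //; exact: conv_hull_col.
Qed.

End SmoothVertex.

(** * Deformations of a facet description with the same normal fan *)

Section Deformation.
Context {R : realType} {m n : nat}.
Implicit Types (A : 'M[int]_(m, n)) (c : 'cV[int]_m) (P : set 'cV[R]_n).
Implicit Types (U W : 'M[int]_n) (v w x d : 'cV[R]_n).

Definition tight A c x (i : 'I_m) : Prop :=
  dotp (toR R (row i A)) x = (c i 0)%:~R.

Lemma tight_max_face A c x i : polyhedron A c x -> tight A c x i ->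
  max_face (polyhedron A c) (toR R (row i A)) x.
Proof. by move=> Px xi; split=> // y Py; rewrite xi; exact: Py. Qed.

Lemma feasible_direction A c x d : polyhedron A c x ->
  (forall i, tight A c x i -> dotp (toR R (row i A)) d <= 0) ->
  exists2 e : R, 0 < e & polyhedron A c (x + e *: d).
Proof.
move=> Px xd; pose slack i := (c i 0)%:~R - dotp (toR R (row i A)) x.
have slack_ge0 i : 0 <= slack i by rewrite subr_ge0; exact: Px.
pose p i := if slack i == 0 then 1 else slack i.
have p0 i : 0 < p i.
  by rewrite /p; case: eqVneq => // si; rewrite lt_def si slack_ge0.
have [e e0 eP] := small_perturbation _ _ _ (fun i => - dotp (toR R (row i A)) d) p0.
exists e => // i; have := eP i; rewrite /p dotpD dotpZ.
case: eqVneq => [/eqP|_ se]; last by move: se; rewrite /slack; lra.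
rewrite subr_eq0 => /eqP xi _; rewrite -xi gerDl pmulr_rle0 //.
exact: xd.
Qed.

Lemma row_basisE A U i k :
  dotp (toR R (row i A)) (col k (toR R U)) = ((A *m U) i k)%:~R.
Proof. by rewrite dotp_col -map_mxM -row_mul !mxE. Qed.

(** Suppose that no row tight at [v] is positively proportional to minus the
    k-th coordinate functional, i.e. is negative on the k-th generator and
    zero on the others. Then a tight row that is negative on the k-th
    generator is also at most -1 on another one, so the direction with
    coordinate -1 on the k-th generator and a large M on the others is
    feasible, although it leaves the tangent cone. Primitivity fixes the
    factor of proportionality. *)
Lemma corner_facet A c U W v k :
  (forall i, primitive (row i A)) -> unimodular_corner (polyhedron A c) v U W ->
  exists i, row i A = - row k W /\ tight A c v i.
Proof.
move=> primA corner; have [WU Pv Wpos _] := corner.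
have tight_le0 i : tight A c v i -> forall l, (A *m U) i l <= 0.
  move=> vi l; rewrite -(lerz0 R) -row_basisE; move: l.
  by apply/(corner_normal_cone _ _ _ _ corner); exact: tight_max_face.
have [i [vi ik il]] : exists i, [/\ tight A c v i, (A *m U) i k < 0 &
    forall l, l != k -> (A *m U) i l = 0].
  apply: contrapT => none.
  (* M outweighs the values of all rows at the k-th generator *)
  pose M : int := \sum_i `|(A *m U) i k|.
  pose z : 'cV[int]_n := \col_l (if l == k then -1 else M).
  have [i vi|e e0 Pe] := feasible_direction _ _ _ (toR R (U *m z)) Pv.
    have -> : dotp (toR R (row i A)) (toR R (U *m z)) =
        (((A *m U) *m z) i 0)%:~R.
      by rewrite /dotp -map_mxM -row_mul mulmxA !mxE.
    rewrite lerz0 mxE (bigD1 k) //= [z k 0]mxE eqxx mulrN1.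
    have Mi : `|(A *m U) i k| <= M.
      by rewrite /M (bigD1 i) //= lerDl sumr_ge0.
    have rest_le0 l : (A *m U) i l * z l 0 <= 0 \/ l = k.
      have [->|lk] := eqVneq l k; [by right|left].
      rewrite [z l 0]mxE (negPf lk) mulr_le0_ge0 ?tight_le0 //.
      by apply: le_trans Mi.
    have ik0 := tight_le0 i vi k; rewrite ler0_norm // in Mi.
    have [[l [lk il]]|allz] :=
      pselect (exists l, l != k /\ (A *m U) i l < 0).
      rewrite (bigD1 l) //= addrA.
      have le1 : (A *m U) i l * z l 0 <= - M.
        rewrite [z l 0]mxE (negPf lk) -mulN1r; apply: ler_wpM2r.
          by apply: le_trans Mi; rewrite oppr_ge0.
        by rewrite -ltzD1.
      have : \sum_(l' | (l' != k) && (l' != l)) (A *m U) i l' * z l' 0 <= 0.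
        by apply: sumr_le0 => l' /andP[/eqP l'k _]; case: (rest_le0 l').
      move: le1 Mi; set a := _ * _; set s := \sum_(_ | _) _; lra.
    have il l : l != k -> (A *m U) i l = 0.
      move=> lk; apply/eqP; rewrite eq_le tight_le0 //= leNgt; apply/negP => il.
      by apply: allz; exists l.
    have -> : (A *m U) i k = 0.
      apply/eqP; rewrite eq_le ik0 leNgt; apply/negP => ik.
      by apply: none; exists i.
    by rewrite oppr0 add0r sumr_le0 // => l /il ->; rewrite mul0r.
  have := Wpos _ Pe k; rewrite addrC addKr dotpZ pmulr_rge0 //.
  rewrite /dotp -map_row -map_mxM mulmxA -row_mul WU -row_mul mul1mx.
  by rewrite !mxE eqxx ler0z.
have Ai : row i A = (A *m U) i k *: row k W.
  rewrite -[A in LHS]mulmx1 -(mulmx1C WU) mulmxA row_mul.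
  apply/matrixP => a b; rewrite !mxE (bigD1 k) //= big1 ?addr0 ?mxE //.
  by move=> l /il; rewrite !mxE => ->; rewrite mul0r.
exists i; split=> //; rewrite Ai.
have : absz ((A *m U) i k) = 1%N.
  by apply: (primA i) => a b; rewrite Ai [X in dvdn _ (absz X)]mxE abszM dvdn_mulr.
move=> b1; have -> : (A *m U) i k = -1.
  by rewrite -[LHS]opprK -(ltz0_abs ik) b1.
by rewrite scaleN1r.
Qed.

(** A row [i] in the normal cone of [v] is a nonnegative combination of the
    rows of [- W], so it is implied by the inequalities [s k] and would be
    redundant if it were not one of them. In particular the rows [s k] are
    exactly those tight at [v]. *)
Lemma corner_facets A c P U W v :
  facet_description A c P -> unimodular_corner P v U W ->
  exists s : 'I_n -> 'I_m,
    (forall k, row (s k) A = - row k W /\ tight A c v (s k)) /\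
    forall i, (forall k, dotp (toR R (row i A)) (col k (toR R U)) <= 0) ->
      exists k, i = s k.
Proof.
move=> [primA PE irred] corner; have [WU Pv _ _] := corner.
have /choice [s sP] : forall k, exists i, row i A = - row k W /\ tight A c v i.
  by move=> k; apply: (corner_facet _ _ U) => //; rewrite -PE.
exists s; split=> // i iU; apply: contrapT => is_.
apply: (irred i); apply/seteqP; split=> [x Px j _|x xP].
  by rewrite PE in Px; exact: Px.
rewrite PE => j; have [->|/xP//] := eqVneq j i.
apply: (@le_trans _ _ (dotp (toR R (row i A)) v)); last first.
  by rewrite PE in Pv; exact: Pv.
rewrite -subr_le0 -dotpN -dotpD (dotp_expansion _ _ WU).
apply: sumr_le0 => k _; apply: mulr_ge0_le0 => //.
have [sk vsk] := sP k; have := xP (s k); rewrite -vsk sk.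
rewrite /toR map_mxN map_row !dotpNl => xv.
rewrite dotpD dotpN subr_ge0 -lerN2; apply: xv.
by apply/eqP => ski; apply: is_; exists k.
Qed.

(** The normal cone of [v] spans the dual space, so a face of the deformed
    polyhedron with this normal cone is a single point [w]. Rows tight at [w]
    lie in that cone, so they are among the rows [s k]. If [s k] were not
    tight at [w], then minus the k-th generator would be a feasible direction
    at [w], and - row k W, which is in the normal cone, increases along it.
    With all the [s k] tight, [W w] is the integer vector of the numbers - c'
    (s k). *)
Lemma corner_deformation A c c' P U W v :
  facet_description A c P -> unimodular_corner P v U W -> vertex P v ->
  normally_isomorphic (polyhedron A c') P ->
  exists w, [/\ forall u, max_face P u v -> max_face (polyhedron A c') u w,
    forall i, tight A c v i -> tight A c' w i,
    unimodular_corner (polyhedron A c') w U W & lattice w].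
Proof.
move=> Adesc corner vvert fanE; have [WU Pv Wpos _] := corner.
have [s [sP s_only]] := corner_facets _ _ _ _ _ _ Adesc corner.
set P' := polyhedron A c'.
have [F [[w Fw] _] Fcone] : normal_fan P' (normal_cone P [set v]).
  by rewrite fanE; exists [set v].
have coneE u : max_face P u v <-> F `<=` max_face P' u.
  have -> : (F `<=` max_face P' u) = normal_cone P' F u by [].
  by rewrite Fcone; split=> [uv _ -> //|]; exact.
have dual_max k : max_face P (- row k (toR R W)) v.
  apply/(corner_normal_cone _ _ _ _ corner) => l.
  by rewrite dotpNl dual_basis // oppr_le0 ler0n.
have Fw1 w' : F w' -> w' = w.
  move=> Fw'; apply: (coordinates_inj _ _ WU) => k.
  have sub := (coneE _).1 (dual_max k).
  have [[P'w wmax] [P'w' w'max]] := (sub _ Fw, sub _ Fw').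
  apply/eqP; rewrite -eqr_opp -!dotpNl eq_le.
  by rewrite wmax ?w'max.
have maxE u : max_face P u v <-> max_face P' u w.
  by rewrite coneE; split=> [|uw _ /Fw1 -> //]; exact.
have [P'w _] : max_face P' 0 w.
  by apply/maxE; split=> // y _; rewrite /dotp !mul0mx.
have tightP i : tight A c' w i -> exists k, i = s k.
  move=> wi; apply: s_only; apply/(corner_normal_cone _ _ _ _ corner).
  by apply/maxE; exact: tight_max_face.
have tight_s k : tight A c' w (s k).
  apply: contrapT => wk.
  have [i wi|e e0 P'e] := feasible_direction _ _ _ (- col k (toR R U)) P'w.
    have [l il] := tightP i wi; subst i; have [-> _] := sP l.
    rewrite /toR map_mxN map_row dotpNl dotpN opprK dual_basis //.
    by case: eqVneq wi => // -> /wk.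
  have [_ /(_ _ P'e)] := (maxE _).1 (dual_max k).
  rewrite dotpD gerDl dotpZ pmulr_rle0 // dotpN dotpNl opprK dual_basis //.
  by rewrite eqxx ler10.
exists w; split.
- by move=> u /maxE.
- move=> i vi; have [|k ->] := s_only i; last exact: tight_s.
  apply/(corner_normal_cone _ _ _ _ corner).
  have [_ PE _] := Adesc; rewrite PE; apply: tight_max_face => //.
  by rewrite -PE.
- split=> // [x P'x k|k].
    have [sk _] := sP k; have := P'x (s k); rewrite -(tight_s k) sk.
    by rewrite /toR map_mxN map_row !dotpNl lerN2 dotpD dotpN subr_ge0.
  apply: feasible_direction => // i /tightP [l ->]; have [-> _] := sP l.
  by rewrite /toR map_mxN map_row dotpNl dual_basis // oppr_le0 ler0n.
exists (U *m \col_k (- c' (s k) 0)) => //.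
apply: (coordinates_inj _ _ WU) => k.
have := tight_s k; rewrite /tight; have [-> _] := sP k.
rewrite /toR map_mxN map_row dotpNl => /eqP; rewrite eqr_oppLR => /eqP ->.
rewrite /dotp -map_row -map_mxM mulmxA -row_mul WU -row_mul mul1mx.
by rewrite !mxE rmorphN.
Qed.

(** The rows tight at a corner contain a basis of the dual space. *)
Lemma tight_determines A c P U W v x y :
  facet_description A c P -> unimodular_corner P v U W ->
  (forall i, tight A c v i ->
     dotp (toR R (row i A)) x = dotp (toR R (row i A)) y) -> x = y.
Proof.
move=> Adesc corner xy; have [WU _ _ _] := corner.
have [s [sP _]] := corner_facets _ _ _ _ _ _ Adesc corner.
apply: (coordinates_inj _ _ WU) => k; have [sk /xy] := sP k.
by rewrite sk /toR map_mxN map_row !dotpNl => /oppr_inj.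
Qed.

(** A point of the deformed polyhedron outside the convex hull of the points
    [w] belonging to the vertices would be separated from them by some
    functional [u]. But [u] attains its maximum on [P] at a vertex, hence its
    maximum on the deformed polyhedron at the corresponding [w]. *)
Lemma polytope_deformation A c c' P k (V : 'M[R]_(n, k)) :
  smooth P -> facet_description A c P -> P = conv_hull V ->
  (forall j, vertex P (col j V)) -> normally_isomorphic (polyhedron A c') P ->
  exists V' : 'M[R]_(n, k),
    [/\ polyhedron A c' = conv_hull V',
        forall i j, tight A c (col j V) i -> tight A c' (col j V') i,
        forall j, lattice (col j V') &
        forall j, exists U W,
          unimodular_corner (polyhedron A c') (col j V') U W].
Proof.
move=> smoothP Adesc PV Vvert fanE; set P' := polyhedron A c'.
have /choice [f fP] : forall j, exists w,
    [/\ forall u, max_face P u (col j V) -> max_face P' u w,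
        forall i, tight A c (col j V) i -> tight A c' w i,
        lattice w & exists U W, unimodular_corner P' w U W].
  move=> j; have [U [W corner]] := smooth_vertex_corner _ _ smoothP (Vvert j).
  have [w [? ? ? ?]] := corner_deformation _ _ _ _ _ _ _ Adesc corner (Vvert j) fanE.
  by exists w; split=> //; exists U, W.
pose V' := \matrix_(i < n, j < k) f j i 0.
have colV' j : col j V' = f j by apply/matrixP => i l; rewrite ord1 !mxE.
exists V'; split=> [|i j|j|j]; rewrite ?colV'; try by have [] := fP j; auto.
apply/seteqP; split=> x; last first.
  move=> V'x i; move: x V'x; apply: dotp_hull_le => j.
  by rewrite colV'; have [_ _ _ [U [W [_ P'j _ _]]]] := fP j; exact: P'j.
move=> P'x; apply: contrapT => /separation [u ux].
have [[x0 Px0] _] : has_dim P n by case: smoothP => -[].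
have [j0 _] : exists j : 'I_k, true.
  move: Px0; rewrite PV => -[w [_ w1] _]; apply: contrapT => nk.
  move: w1; rewrite big1 => [/eqP|j _]; first by rewrite eq_sym oner_eq0.
  by case: nk; exists j.
have [j _ jmax] := @arg_maxP _ _ _ j0 xpredT (fun j => dotp u (col j V)) isT.
have [maxj _ _ _] := fP j.
have [|_ /(_ _ P'x)] := maxj u.
  rewrite PV; split=> [|y]; first exact: conv_hull_col.
  by apply: dotp_hull_le => i; exact: jmax.
by rewrite -colV' leNgt ux.
Qed.

End Deformation.

Lemma smooth_lattice_of_corners (R : realType) (n k : nat)
  (P : set 'cV[R]_n) (V : 'M[R]_(n, k)) :
  P !=set0 -> P = conv_hull V -> (forall j, lattice (col j V)) ->
  (forall j, exists U W, unimodular_corner P (col j V) U W) ->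
  smooth P /\ lattice_polytope P.
Proof.
move=> P0 PV Vlat Vcorner.
have polyP : polytope P by exists k, V.
have vcol v : vertex P v -> exists j, v = col j V.
  by rewrite PV; exact: conv_hull_vertex_col.
split; last by split=> // v /vcol [j ->].
by apply: smooth_of_corners => // v /vcol [j ->].
Qed.

(** * Neatness from Oda's conjecture *)

Theorem theorem2p6 (R : realType) :
  oda_conjecture R ->
  (forall (n : nat) (P : set 'cV[R]_n),
     smooth P -> lattice_polytope P -> P 0 -> neat P) /\
  (forall (n : nat) (P : set 'cV[R]_n), monotone_polytope P -> neat P).
Proof.
move=> oda.
have main (n : nat) (P : set 'cV[R]_n) :
    smooth P -> lattice_polytope P -> P 0 -> neat P.
  move=> smoothP [polyP _] P0 m A c Adesc b fan_b fan_Nb.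
  have [k [V [PV Vvert]]] := polytope_vertices _ polyP.
  have [Vb [VbE Vb_tight Vb_lat Vb_corner]] :=
    polytope_deformation _ _ _ _ _ _ smoothP Adesc PV Vvert fan_b.
  have [Vn [VnE Vn_tight Vn_lat Vn_corner]] :=
    polytope_deformation _ _ _ _ _ _ smoothP Adesc PV Vvert fan_Nb.
  have [w [w0 w1] Vw] : conv_hull V 0 by rewrite -PV.
  have sumV : Vb + Vn = V + V.
    apply/matrixP => i j.
    suff /matrixP/(_ i 0) : col j Vb + col j Vn = col j V + col j V.
      by rewrite !mxE.
    have [U [W corner]] := smooth_vertex_corner _ _ smoothP (Vvert j).
    apply: (tight_determines _ _ _ _ _ _ _ _ Adesc corner) => l vl.
    rewrite !dotpD (Vb_tight _ _ vl) (Vn_tight _ _ vl) vl !mxE rmorphB rmorphD.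
    by rewrite addrACA subrr addr0.
  have Pb_w : polyhedron A (c + b) (Vb *m w) by rewrite VbE; exists w.
  have Pn_w : polyhedron A (c - b) (Vn *m w) by rewrite VnE; exists w.
  have [_ lat_b] := smooth_lattice_of_corners _ _ _ _ _
    (ex_intro _ _ Pb_w) VbE Vb_lat Vb_corner.
  have [smooth_n lat_n] := smooth_lattice_of_corners _ _ _ _ _
    (ex_intro _ _ Pn_w) VnE Vn_lat Vn_corner.
  have fan_ref : refines (normal_fan (polyhedron A (c - b)))
      (normal_fan (polyhedron A (c + b) : set 'cV[R]_n)).
    by rewrite fan_Nb fan_b; split=> // C PC; exists C.
  have : (minkowski_sum (polyhedron A (c + b)) (polyhedron A (c - b))
      `&` @lattice R n) 0.
    split; last by exists 0 => //; rewrite /toR map_mx0.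
    exists (Vb *m w) => //; exists (Vn *m w) => //.
    by rewrite -mulmxDl sumV mulmxDl Vw addr0.
  rewrite oda // => -[p [Pp lat_p] [q [Pq _] /eqP]].
  rewrite addr_eq0 => /eqP pq.
  by exists p; split=> //; split=> //; exists q.
split=> // n P [smoothP [latP int0 _]].
by apply: main => //; exact: interior_subset.
Qed.
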